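(* Let $G=B*_A C$ be an amalgamated free product, where $A,B,C$ are finitely generated groups such that both $B$ and $C$ have decidable word problem, and the membership problem for $A$ in $B$ and the membership problem for $A$ in $C$ are both decidable. Let $M$ be a submonoid of $G$ such that the following conditions hold: (i) $A\subseteq M$; (ii) both $M\cap B$ and $M\cap C$ are finitely generated monoids, and $M$ is generated, as a monoid, by $(M\cap B)\cup(M\cap C)$; (iii) the membership problem for $M\cap B$ in $B$ is decidable; (iv) the membership problem for $M\cap C$ in $C$ is decidable. Then the membership problem for $M$ in $G$ is decidable.
   Context: $B*_A C$ denotes the free product of groups $B$ and $C$ amalgamated over $A$ with respect to injective homomorphisms $f:A\to B$ and $g:A\to C$; the groups $A,B,C$ are identified with their images in $G=B*_AC$, so that $B\cap C=A$. All groups come with fixed finite generating sets: $B$ is generated by $X$, $C$ by $Y$, $A$ by $Z$, and $G$ by $X\cup Y$; the images of the generators of $A$ under $f$ and $g$ are given by fixed words over the generators of $B$ and $C$. For a set $\Omega$ write $\overline{\Omega}=\Omega\cup\Omega^{-1}$. For a group $K$ with finite generating set $\Omega$ and canonical homomorphism $\pi:\overline{\Omega}^*\to K$ and a (finitely generated) submonoid or subgroup $N$ of $K$, the membership problem for $N$ in $K$ is decidable if there is an algorithm which, given any word $w\in\overline{\Omega}^*$, decides whether $w\pi\in N$. *)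

(* Defs.v *)
From HB Require Import structures.
From mathcomp Require Import all_boot.
From mathcomp Require Import boolp classical_sets functions cardinality.

Set Implicit Arguments.
Unset Strict Implicit.
Unset Printing Implicit Defensive.

Local Open Scope classical_set_scope.

(* The total (general) recursive functions nat^k -> nat: the closure of the
   basic functions under composition, primitive recursion, and minimization of
   regular functions, i.e. of those h for which a zero always exists.
   The last constructor closes the class under pointwise equality. *)
Inductive recursive : forall k : nat, (k.-tuple nat -> nat) -> Prop :=
| recursive_zero k : @recursive k (fun=> 0)
| recursive_succ : @recursive 1 (fun v => (thead v).+1)
| recursive_proj k (i : 'I_k) : @recursive k (fun v => tnth v i)
| recursive_comp k n (h : n.-tuple nat -> nat) (t : 'I_n -> k.-tuple nat -> nat) :
    recursive h -> (forall i, recursive (t i)) ->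
    @recursive k (fun v => h [tuple t i v | i < n])
| recursive_prim k (b : k.-tuple nat -> nat) (h : k.+2.-tuple nat -> nat) :
    recursive b -> recursive h ->
    @recursive k.+1 (fun v =>
      iteri (thead v)
        (fun i y => h (cons_tuple i (cons_tuple y (behead_tuple v))))
        (b (behead_tuple v)))
| recursive_mu k (h : k.+1.-tuple nat -> nat)
    (hreg : forall v : k.-tuple nat, exists n, h (cons_tuple n v) == 0) :
    recursive h -> @recursive k (fun v => ex_minn (hreg v))
| recursive_ext k (h h' : k.-tuple nat -> nat) :
    h =1 h' -> recursive h -> recursive h'.

(* Words over p generators and their formal inverses: the letter (i, false)
   stands for the i-th generator and (i, true) for its inverse. *)
Definition letter (p : nat) := ('I_p * bool)%type.

Definition word_code (p : nat) (w : seq (letter p)) : nat :=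
  CodeSeq.code [seq (nat_of_ord l.1).*2 + l.2 | l : letter p <- w].

Definition decidable_words (p : nat) (P : set (seq (letter p))) : Prop :=
  exists2 chi : 1.-tuple nat -> nat, recursive chi &
    forall w, chi [tuple word_code w] = `[< P w >].

Notation "{ 'group_hom' G -> H }" := (UMagmaMorphism.type G H)
  (at level 0, G at level 98, H at level 99,
   format "{ 'group_hom'  G  ->  H }") : type_scope.

Section Groups.
Variable K : groupType.

(* The canonical homomorphism from words to K. Repetitions in X are allowed. *)
Definition word_value (p : nat) (X : p.-tuple K) (w : seq (letter p)) : K :=
  (\prod_(l <- w) (if l.2 then (tnth X l.1)^-1 else tnth X l.1))%g.

Definition generates (p : nat) (X : p.-tuple K) : Prop :=
  forall x : K, exists w, word_value X w = x.

Definition decidable_membership (p : nat) (X : p.-tuple K) (N : set K) : Prop :=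
  decidable_words [set w | N (word_value X w)].

Definition decidable_word_problem (p : nat) (X : p.-tuple K) : Prop :=
  decidable_words [set w | word_value X w = 1%g].

Definition submonoid (N : set K) : Prop :=
  N 1%g /\ forall x y, N x -> N y -> N (x * y)%g.

Definition submonoid_generated (S : set K) : set K := smallest submonoid S.

Definition finitely_generated_submonoid (N : set K) : Prop :=
  exists2 S : set K, finite_set S & N = submonoid_generated S.

End Groups.

(* (G, iB, iC) is the pushout of f and g. When f and g are injective this is
   the free product of B and C amalgamated over A, and iB and iC are the
   (then injective) maps by which B and C are identified with subgroups of G. *)
Definition amalgamated_product (A B C G : groupType)
    (f : {group_hom A -> B}) (g : {group_hom A -> C})
    (iB : {group_hom B -> G}) (iC : {group_hom C -> G}) : Prop :=
  [/\ injective f, injective g,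
      forall a, iB (f a) = iC (g a) &
      forall (H : groupType) (u : {group_hom B -> H}) (v : {group_hom C -> H}),
        (forall a, u (f a) = v (g a)) ->
        exists h : {group_hom G -> H},
          [/\ forall b, h (iB b) = u b, forall c, h (iC c) = v c &
              forall h' : {group_hom G -> H},
                (forall b, h' (iB b) = u b) -> (forall c, h' (iC c) = v c) ->
                h' =1 h]].

(* Main.v *)
Require Import Defs.
From HB Require Import structures.
From mathcomp Require Import all_boot.
From mathcomp Require Import boolp classical_sets functions cardinality.

(* Every coset A k in B or C is represented by the element with the least word
   code in it, and G acts on the normal forms a t_1 ... t_n, with a in A and the
   t_i nontrivial coset representatives taken alternately from B and C: by the
   universal property it is enough to let B and C act compatibly on A. Since M
   contains the group A, the generators of M in B and in C preserve the set of
   normal forms all of whose t_i lie in M; conversely x is the product of its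
   normal form. Hence x is in M if and only if every t_i in the normal form of x
   is in M. The normal form of a word is computed letter by letter: an element
   of B or C is rewritten as a t by two unbounded searches, for a representative
   t and for a word in the generators of A. *)

Set Implicit Arguments.
Unset Strict Implicit.
Unset Printing Implicit Defensive.

Local Open Scope classical_set_scope.

(** * Recursive functions *)

Lemma recursive_thead k : @recursive k.+1 (fun u => thead u).
Proof. exact: recursive_proj. Qed.

(** [recursive_comp] only builds tuples of the form [[tuple t i v | i < n]]; extensionality of
    tuples extends it to any map with recursive components. *)
Lemma recursive_subst j k (F : j.-tuple nat -> nat)
    (t : k.-tuple nat -> j.-tuple nat) :
  recursive F -> (forall i, recursive (fun v => tnth (t v) i)) ->
  recursive (fun v => F (t v)).
Proof.
move=> rF rt; apply: recursive_ext (recursive_comp rF rt) => v; congr F.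
by apply: eq_from_tnth => i; rewrite tnth_mktuple.
Qed.

Lemma recursive_cons j k (H : k.-tuple nat -> nat)
    (t : k.-tuple nat -> j.-tuple nat) :
  recursive H -> (forall i, recursive (fun v => tnth (t v) i)) ->
  forall i, recursive (fun v => tnth (cons_tuple (H v) (t v)) i).
Proof.
move=> rH rt i; case: (unliftP ord0 i) => [i' ->|->].
  by apply: recursive_ext (rt i') => v; rewrite tnthS.
by apply: recursive_ext rH.
Qed.

Lemma recursive_tnth_behead k (i : 'I_k) :
  @recursive k.+1 (fun u => tnth (behead_tuple u) i).
Proof.
apply: recursive_ext (recursive_proj (lift ord0 i)) => u.
by case/tupleP: u => x v; rewrite tnthS !(tnth_nth 0).
Qed.

Lemma recursive_behead k (F : k.-tuple nat -> nat) :
  recursive F -> @recursive k.+1 (fun u => F (behead_tuple u)).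
Proof.
move=> rF; have := recursive_subst
  (t := fun u : k.+1.-tuple nat => behead_tuple u) rF.
apply; exact: recursive_tnth_behead.
Qed.

Lemma recursive_let k (F : k.+1.-tuple nat -> nat) (H : k.-tuple nat -> nat) :
  recursive F -> recursive H -> recursive (fun v => F (cons_tuple (H v) v)).
Proof.
move=> rF rH; apply: (recursive_subst (t := fun v => cons_tuple (H v) v)) => //.
by apply: (recursive_cons (t := id)) => // i; exact: recursive_proj.
Qed.

Lemma recursive_comp1 k (h : nat -> nat) (F : k.-tuple nat -> nat) :
  recursive (fun u : 1.-tuple nat => h (thead u)) -> recursive F ->
  recursive (fun v => h (F v)).
Proof.
move=> rh rF; apply: recursive_ext (recursive_comp rh (fun=> rF)) => v.
by rewrite /thead tnth_mktuple.
Qed.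

Lemma recursive_S k (F : k.-tuple nat -> nat) :
  recursive F -> recursive (fun v => (F v).+1).
Proof. exact: recursive_comp1 recursive_succ. Qed.

Lemma recursive_const k n : recursive (fun _ : k.-tuple nat => n).
Proof. by elim: n => [|n]; [exact: recursive_zero|exact: recursive_S]. Qed.

(** Primitive recursion with the counter dropped; the parameters [v] reach the step as the tail of
    its argument, behind the accumulator. *)
Lemma recursive_iter k (F H : k.-tuple nat -> nat)
    (h : k.-tuple nat -> nat -> nat) :
  recursive F -> recursive H ->
  @recursive k.+1 (fun u => h (behead_tuple u) (thead u)) ->
  recursive (fun v => iter (F v) (h v) (H v)).
Proof.
move=> rF rH rh.
have := recursive_let (recursive_prim rH (recursive_behead rh)) rF.
apply: recursive_ext => v.
have beheadK j n (u : j.-tuple nat) : behead_tuple (cons_tuple n u) = u.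
  exact: val_inj.
rewrite theadE beheadK; elim: (F v) => //= n ->.
by rewrite !beheadK theadE.
Qed.

Lemma recursive_pred k (F : k.-tuple nat -> nat) :
  recursive F -> recursive (fun v => (F v).-1).
Proof.
apply: recursive_comp1.
(* The step returns the counter and forgets the accumulator, so n rounds end in n - 1, and no round
   in 0. *)
have := recursive_prim (recursive_const 0 0) (recursive_thead 1).
by apply: recursive_ext => v; case: (thead v).
Qed.

Lemma recursive_add k (F H : k.-tuple nat -> nat) :
  recursive F -> recursive H -> recursive (fun v => F v + H v).
Proof.
move=> rF rH.
have := recursive_iter (h := fun=> S) rF rH (recursive_S (recursive_thead k)).
by apply: recursive_ext => v; elim: (F v) => //= n ->; rewrite addSn.
Qed.

Lemma recursive_sub k (F H : k.-tuple nat -> nat) :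
  recursive F -> recursive H -> recursive (fun v => F v - H v).
Proof.
move=> rF rH.
have := recursive_iter (h := fun=> predn) rH rF
  (recursive_pred (recursive_thead k)).
by apply: recursive_ext => v; elim: (H v) => [|n /= ->]; rewrite ?subn0 ?subnS.
Qed.

(** The boolean serves as a number of rounds, 0 or 1: start from [H v] and overwrite it by [F v]. *)
Lemma recursive_if k (c : k.-tuple nat -> bool) (F H : k.-tuple nat -> nat) :
  recursive (fun v => c v : nat) -> recursive F -> recursive H ->
  recursive (fun v => if c v then F v else H v).
Proof.
move=> rc rF rH.
have := recursive_iter (h := fun v _ => F v) rc rH (recursive_behead rF).
by apply: recursive_ext => v; case: (c v).
Qed.

Lemma recursive_negb k (c : k.-tuple nat -> bool) :
  recursive (fun v => c v : nat) -> recursive (fun v => ~~ c v : nat).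
Proof.
move=> rc; have := recursive_if rc (recursive_const k 0) (recursive_const k 1).
by apply: recursive_ext => v; case: (c v).
Qed.

Lemma recursive_leq k (F H : k.-tuple nat -> nat) :
  recursive F -> recursive H -> recursive (fun v => (F v <= H v)%N : nat).
Proof.
move=> rF rH.
have := recursive_iter (h := fun _ _ => 0)
  (recursive_sub rF rH) (recursive_const k 1)
  (recursive_const k.+1 0).
by apply: recursive_ext => v; rewrite /leq; case: (F v - H v).
Qed.

Lemma recursive_eq0 k (F : k.-tuple nat -> nat) :
  recursive F -> recursive (fun v => F v == 0 : nat).
Proof.
move=> rF; have := recursive_leq rF (recursive_const k 0).
by apply: recursive_ext => v; rewrite leqn0.
Qed.

Lemma recursive_double k (F : k.-tuple nat -> nat) :
  recursive F -> recursive (fun v => (F v).*2).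
Proof.
move=> rF; have := recursive_add rF rF.
by apply: recursive_ext => v; rewrite addnn.
Qed.

Lemma eq_ex_minn (P Q : pred nat) (hP : exists n, P n) (hQ : exists n, Q n) :
  P =1 Q -> ex_minn hP = ex_minn hQ.
Proof.
move=> PQ; case: ex_minnP => m Pm minm; case: ex_minnP => n Qn minn.
by apply/eqP; rewrite eqn_leq minm ?PQ // minn -?PQ.
Qed.

(** [recursive_mu] looks for a least zero, so it is applied to the negation of [P]. *)
Lemma recursive_ex_minn k (P : k.-tuple nat -> nat -> bool)
    (hP : forall v, exists n, P v n) :
  @recursive k.+1 (fun u => P (behead_tuple u) (thead u) : nat) ->
  recursive (fun v => ex_minn (hP v)).
Proof.
move=> /recursive_negb rP.
have PE v n :
    (~~ P (behead_tuple (cons_tuple n v)) (thead (cons_tuple n v)) == 0 :> nat) =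
    P v n.
  by rewrite theadE eqb0 negbK; congr P; apply: val_inj.
have hreg v : exists n,
    (~~ P (behead_tuple (cons_tuple n v)) (thead (cons_tuple n v)) : nat) == 0.
  by have [n Pn] := hP v; exists n; rewrite PE.
apply: recursive_ext (recursive_mu hreg rP) => v.
by apply: eq_ex_minn => n; rewrite PE.
Qed.

Lemma recursive_half k (F : k.-tuple nat -> nat) :
  recursive F -> recursive (fun v => (F v)./2).
Proof.
move=> rF.
(* Half of m is the least n with m <= 2n + 1. *)
have hP (v : k.-tuple nat) : exists n, (F v <= n.*2.+1)%N.
  by exists (F v); rewrite -addnn ltnW // ltnS leq_addr.
have := recursive_ex_minn (P := fun v n => (F v <= n.*2.+1)%N) hP
  (recursive_leq (recursive_behead rF)
  (recursive_S (recursive_double (recursive_thead k)))).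
apply: recursive_ext => v; case: ex_minnP => n le_Fn minn.
by apply/eqP; rewrite eqn_leq minn -?leq_half_double // leq_half_double.
Qed.

Lemma recursive_odd k (F : k.-tuple nat -> nat) :
  recursive F -> recursive (fun v => odd (F v) : nat).
Proof.
move=> rF; have := recursive_sub rF (recursive_double (recursive_half rF)).
by apply: recursive_ext => v; rewrite -{1}[F v]odd_double_half addnK.
Qed.

(** * Codes of sequences *)

(** This is how [CodeSeq.code] attaches a head: the head is the exponent of 2, the tail is read off
    the odd part, and 0 codes the empty sequence. *)
Definition code_cons a b := 2 ^ a * b.*2.+1.
Definition code_head x := head 0 (CodeSeq.decode x).
Definition code_behead x := CodeSeq.code (behead (CodeSeq.decode x)).

Lemma code_consE a b : code_cons a b = iter a double b.*2.+1.
Proof.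
by elim: a => [|a IHa]; rewrite /code_cons ?mul1n //= -IHa expnS -mulnA mul2n.
Qed.

Lemma recursive_code_cons k (F H : k.-tuple nat -> nat) :
  recursive F -> recursive H -> recursive (fun v => code_cons (F v) (H v)).
Proof.
move=> rF rH.
have := recursive_iter (h := fun=> double) rF (recursive_S (recursive_double rH))
  (recursive_double (recursive_thead k)).
by apply: recursive_ext => v; rewrite code_consE.
Qed.

Lemma code_consP x : x != 0 -> x = code_cons (code_head x) (code_behead x).
Proof.
rewrite -[x in x != 0]CodeSeq.decodeK -[x in LHS]CodeSeq.decodeK.
by rewrite /code_head /code_behead; case: CodeSeq.decode.
Qed.

Lemma iter_half_code_cons a b : iter a half (code_cons a b) = b.*2.+1.
Proof.
by rewrite code_consE; elim: a => // a IHa; rewrite iterSr /= doubleK IHa.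
Qed.

Lemma recursive_code_head k (F : k.-tuple nat -> nat) :
  recursive F -> recursive (fun v => code_head (F v)).
Proof.
move=> rF.
(* The head of a nonzero code is the least number of halvings that gives an odd number; for 0 the
   search stops at once, at the default head 0. *)
pose P v n := if F v == 0 then true else odd (iter n half (F v)).
have hP v : exists n, P v n.
  rewrite /P; case: eqVneq => [_|/code_consP ->]; first by exists 0.
  by exists (code_head (F v)); rewrite iter_half_code_cons /= odd_double.
have rP : @recursive k.+1 (fun u => P (behead_tuple u) (thead u) : nat).
  have rF' := recursive_behead rF.
  have := recursive_if (recursive_eq0 rF') (recursive_const k.+1 1)
    (recursive_odd (recursive_iter (h := fun=> half) (recursive_thead k) rF'
      (recursive_half (recursive_thead k.+1)))).
  by apply: recursive_ext => u; rewrite /P; case: ifP.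
apply: recursive_ext (recursive_ex_minn hP rP) => v.
case: ex_minnP; rewrite /P; case: eqVneq => [-> n _ /(_ 0 isT)|/code_consP].
  by rewrite leqn0 => /eqP.
set a := code_head _; set b := code_behead _ => -> n odd_n min_n.
apply/eqP; rewrite eqn_leq min_n ?iter_half_code_cons /= ?odd_double //.
(* With fewer than [a] halvings a factor 2 is left over, so the result is still even. *)
rewrite leqNgt; apply: contraL odd_n => lt_na.
have -> : code_cons a b = iter n double (code_cons (a - n) b).
  by rewrite !code_consE -iterD subnKC // ltnW.
have halfK y : iter n half (iter n double y) = y.
  by elim: (n) => // m IHm; rewrite iterSr iterS doubleK.
rewrite halfK /code_cons oddM oddX /=; by rewrite subn_eq0 leqNgt lt_na.
Qed.

Lemma recursive_code_behead k (F : k.-tuple nat -> nat) :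
  recursive F -> recursive (fun v => code_behead (F v)).
Proof.
move=> rF; have := recursive_half (recursive_iter (h := fun=> half)
  (recursive_code_head rF) rF (recursive_half (recursive_thead k))).
apply: recursive_ext => v.
have [->|/code_consP F0] := eqVneq (F v) 0; first by [].
by rewrite {2}F0 iter_half_code_cons /= uphalf_double.
Qed.

Definition code_foldl (h : nat -> nat -> nat) a x :=
  foldl h a (CodeSeq.decode x).

(** Bounds the number of rounds that a fold over the sequence takes by the code itself. *)
Lemma size_decode x : (size (CodeSeq.decode x) <= x)%N.
Proof.
rewrite -{2}[x]CodeSeq.decodeK; elim: (CodeSeq.decode x) => //= n s IHs.
apply: leq_trans (leq_pmull _ _); last by rewrite expn_gt0.
by rewrite ltnS (leq_trans IHs) // -addnn leq_addr.
Qed.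

(* The pair of the accumulator and the remaining sequence is itself coded by
   [code_cons]. *)
Definition code_foldl_step (h : nat -> nat -> nat) p :=
  if code_behead p == 0 then p else
  code_cons (h (code_head p) (code_head (code_behead p)))
            (code_behead (code_behead p)).

Lemma code_headK a b : code_head (code_cons a b) = a.
Proof.
by rewrite /code_head -[b]CodeSeq.decodeK
  -[code_cons _ _]/(CodeSeq.code (_ :: _)) CodeSeq.codeK.
Qed.

Lemma code_beheadK a b : code_behead (code_cons a b) = b.
Proof.
by rewrite /code_behead -[b in LHS]CodeSeq.decodeK
  -[code_cons _ _]/(CodeSeq.code (_ :: _)) CodeSeq.codeK /= CodeSeq.decodeK.
Qed.

Lemma iter_code_foldl_step h m a s : (size s <= m)%N ->
  iter m (code_foldl_step h) (code_cons a (CodeSeq.code s)) =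
  code_cons (foldl h a s) 0.
Proof.
(* A state with nothing left to read is fixed, so surplus rounds are harmless. *)
have step0 b : code_foldl_step h (code_cons b 0) = code_cons b 0.
  by rewrite /code_foldl_step code_beheadK.
have stepS b c x :
    code_foldl_step h (code_cons b (code_cons c x)) = code_cons (h b c) x.
  rewrite /code_foldl_step code_beheadK muln_eq0 expn_eq0 !code_headK.
  by rewrite code_beheadK.
elim: m a s => [|m IHm] a [|c s] // le_sm; rewrite iterSr.
  by rewrite step0 (IHm _ [::]).
by rewrite stepS IHm.
Qed.

Lemma recursive_code_foldl k (F H : k.-tuple nat -> nat)
    (h : k.-tuple nat -> nat -> nat -> nat) :
  @recursive k.+2 (fun w => h (behead_tuple (behead_tuple w))
     (thead (behead_tuple w)) (thead w)) ->
  recursive H -> recursive F ->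
  recursive (fun v => code_foldl (h v) (H v) (F v)).
Proof.
move=> rh rH rF.
pose p := fun u : k.+1.-tuple nat => thead u.
have rp : recursive p := recursive_thead k.
have rt := recursive_code_behead rp.
have rh' : recursive (fun u : k.+1.-tuple nat =>
    h (behead_tuple u) (code_head (p u)) (code_head (code_behead (p u)))).
  pose t (u : k.+1.-tuple nat) := cons_tuple (code_head (code_behead (p u)))
    (cons_tuple (code_head (p u)) (behead_tuple u)).
  apply: recursive_ext (recursive_subst (t := t) rh _) => [u|].
    by rewrite !theadE; congr h; exact: val_inj.
  apply: recursive_cons; first exact: recursive_code_head.
  apply: recursive_cons; first exact: recursive_code_head.
  exact: recursive_tnth_behead.
have rstep := recursive_if (recursive_eq0 rt) rp
  (recursive_code_cons rh' (recursive_code_behead rt)).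
have := recursive_code_head (recursive_iter
  (h := fun v => code_foldl_step (h v)) rF (recursive_code_cons rH rF) rstep).
apply: recursive_ext => v.
rewrite -{2}[F v]CodeSeq.decodeK iter_code_foldl_step ?size_decode //.
by rewrite code_headK.
Qed.

Definition code_revcat x y := code_foldl (fun a c => code_cons c a) y x.
Definition code_cat x y := code_revcat (code_revcat x 0) y.
(** A generator and its inverse are the letters 2i and 2i + 1, so inverting a letter flips its
    parity; consing onto the accumulator reverses the word. *)
Definition code_inv x :=
  code_foldl (fun a c => code_cons (if odd c then c.-1 else c.+1) a) 0 x.
Definition code_subst t x := code_foldl (fun a c => code_cat a (t c)) 0 x.

Lemma decode_code_cons a x :
  CodeSeq.decode (code_cons a x) = a :: CodeSeq.decode x.
Proof.
by rewrite -{1}[x]CodeSeq.decodeK -[code_cons _ _]/(CodeSeq.code (_ :: _))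
  CodeSeq.codeK.
Qed.

Lemma decode_revcat x y : CodeSeq.decode (code_revcat x y) =
  catrev (CodeSeq.decode x) (CodeSeq.decode y).
Proof.
rewrite /code_revcat /code_foldl.
by elim: (CodeSeq.decode x) y => //= c s IHs y; rewrite IHs decode_code_cons.
Qed.

Lemma decode_cat x y :
  CodeSeq.decode (code_cat x y) = CodeSeq.decode x ++ CodeSeq.decode y.
Proof. by rewrite !decode_revcat catrevE revK. Qed.

Lemma decode_inv x : CodeSeq.decode (code_inv x) =
  rev [seq if odd c then c.-1 else c.+1 | c <- CodeSeq.decode x].
Proof.
rewrite /code_inv /code_foldl /rev -[[::]]/(CodeSeq.decode 0).
by elim: (CodeSeq.decode x) 0 => //= c s IHs y; rewrite IHs decode_code_cons.
Qed.

Lemma decode_subst t x : CodeSeq.decode (code_subst t x) =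
  flatten [seq CodeSeq.decode (t c) | c <- CodeSeq.decode x].
Proof.
rewrite /code_subst /code_foldl -[RHS]/(CodeSeq.decode 0 ++ _).
elim: (CodeSeq.decode x) 0 => [|c s IHs] y /=; first by rewrite cats0.
by rewrite IHs decode_cat -catA.
Qed.

Lemma recursive_code_revcat k (F H : k.-tuple nat -> nat) :
  recursive F -> recursive H -> recursive (fun v => code_revcat (F v) (H v)).
Proof.
move=> rF rH.
apply: (recursive_code_foldl (h := fun _ a c => code_cons c a)) => //.
exact: recursive_code_cons (recursive_thead _)
  (recursive_behead (recursive_thead _)).
Qed.

Lemma recursive_code_cat k (F H : k.-tuple nat -> nat) :
  recursive F -> recursive H -> recursive (fun v => code_cat (F v) (H v)).
Proof.
move=> rF rH; apply: recursive_code_revcat rH.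
exact: recursive_code_revcat (recursive_const k 0).
Qed.

Lemma recursive_code_inv k (F : k.-tuple nat -> nat) :
  recursive F -> recursive (fun v => code_inv (F v)).
Proof.
move=> rF; apply: (recursive_code_foldl (h := fun _ a c =>
  code_cons (if odd c then c.-1 else c.+1) a)) => //;
  last exact: recursive_const.
have rc := recursive_thead k.+1.
apply: recursive_code_cons (recursive_behead (recursive_thead _)).
exact: recursive_if (recursive_odd rc) (recursive_pred rc) (recursive_S rc).
Qed.

Lemma recursive_code_subst k (t : nat -> nat) (F : k.-tuple nat -> nat) :
  @recursive 1 (fun u => t (thead u)) -> recursive F ->
  recursive (fun v => code_subst t (F v)).
Proof.
move=> rt rF; apply: (recursive_code_foldl (h := fun _ a c => code_cat a (t c)))
  => //; last exact: recursive_const.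
apply: recursive_code_cat; first exact: recursive_behead (recursive_thead _).
exact: recursive_comp1 rt (recursive_thead _).
Qed.

(** A finite table is recursive; the words for the images of the generators of A enter the algorithm
    this way. *)
Lemma recursive_nth k (s : seq nat) (F : k.-tuple nat -> nat) :
  recursive F -> recursive (fun v => nth 0 s (F v)).
Proof.
elim: s F => [|n s IHs] F rF.
  by apply: recursive_ext (recursive_const k 0) => v; rewrite nth_nil.
have := recursive_if (recursive_eq0 rF) (recursive_const k n)
  (IHs _ (recursive_pred rF)).
by apply: recursive_ext => v; case: (F v).
Qed.

(** * The action on normal forms *)

(** Permutations carrying their inverse as data; they form the group to which the universal property
    of G is applied. *)
Record symmetry (T : Type) := Symmetry {
  symmetry_fun :> T -> T;
  symmetry_inv : T -> T;
  symmetryK : cancel symmetry_fun symmetry_inv;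
  symmetryVK : cancel symmetry_inv symmetry_fun }.

HB.instance Definition _ T := gen_eqMixin (symmetry T).
HB.instance Definition _ T := gen_choiceMixin (symmetry T).

Section SymmetryGroup.
Variable T : Type.
Implicit Types s t : symmetry T.

Lemma symmetry_eq s t : s =1 t -> s = t.
Proof.
case: s t => [s s' sK s'K] [t t' tK t'K] /= /funext est; subst t.
have est' : s' = t' by apply: funext => x; rewrite -{1}[x]t'K sK.
by subst t'; congr Symmetry; exact: Prop_irrelevance.
Qed.

Definition symmetry_one := @Symmetry T id id (frefl _) (frefl _).
Definition symmetry_opp s := Symmetry (@symmetryVK _ s) (@symmetryK _ s).
Definition symmetry_mul s t :=
  Symmetry (can_comp (@symmetryK _ s) (@symmetryK _ t))
           (can_comp (@symmetryVK _ t) (@symmetryVK _ s)).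

Lemma symmetry_mulA : associative symmetry_mul.
Proof. by move=> r s t; apply: symmetry_eq. Qed.

Lemma symmetry_mul1s : left_id symmetry_one symmetry_mul.
Proof. by move=> s; apply: symmetry_eq. Qed.

Lemma symmetry_muls1 : right_id symmetry_one symmetry_mul.
Proof. by move=> s; apply: symmetry_eq. Qed.

Lemma symmetry_mulVs : left_inverse symmetry_one symmetry_opp symmetry_mul.
Proof. by move=> s; apply: symmetry_eq; exact: symmetryK. Qed.

Lemma symmetry_mulsV : right_inverse symmetry_one symmetry_opp symmetry_mul.
Proof. by move=> s; apply: symmetry_eq; exact: symmetryVK. Qed.

HB.instance Definition _ := isGroup.Build (symmetry T)
  symmetry_mulA symmetry_mul1s symmetry_muls1 symmetry_mulVs symmetry_mulsV.

Lemma symmetryME s t x : (s * t)%g x = s (t x). Proof. by []. Qed.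

End SymmetryGroup.

(* The representatives t_1 ... t_n of a normal form are listed as numbers
   [s + n.*2], where [s] is false for B and true for C, and [n] is the code of a
   word; 0 is the code of the empty word, which represents the trivial coset. *)
Section NormalForms.
Variable isrep : bool -> nat -> bool.

(** A syllable from factor [s] may be put in front of [w] without breaking the alternation. *)
Definition fresh (s : bool) (w : seq nat) :=
  if w is e :: _ then odd e != s else true.

Fixpoint valid (w : seq nat) :=
  if w is e :: w' then
    [&& (0 < e./2)%N, isrep (odd e) e./2, fresh (odd e) w' & valid w']
  else true.

(** If the leading syllable is not from factor [s], the trivial representative 0 is split off
    instead, and [push] absorbs it again; the action then needs no case distinction. *)
Definition top (s : bool) (w : seq nat) :=
  if w is e :: _ then if odd e == s then e./2 else 0 else 0.

Definition pop (s : bool) (w : seq nat) :=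
  if w is e :: w' then if odd e == s then w' else w else w.

Definition push (s : bool) (n : nat) (w : seq nat) :=
  if n == 0 then w else s + n.*2 :: w.

Lemma push_topK s w : valid w -> push s (top s w) (pop s w) = w.
Proof.
case: w => //= e w /and4P[e_gt0 _ _ _]; case: eqP => // <-.
by rewrite /push gtn_eqF // odd_double_half.
Qed.

Lemma fresh_pop s w : valid w -> fresh s (pop s w).
Proof.
case: w => //= e w /and4P[_ _ fw _]; case: (boolP (odd e == s)) => //.
by move=> /eqP <-.
Qed.

Lemma valid_pop s w : valid w -> valid (pop s w).
Proof. by case: w => //= e w vw; case: ifP => // _; case/and4P: vw. Qed.

Lemma fresh_top s w : fresh s w -> top s w = 0.
Proof. by case: w => //= e w /negPf ->. Qed.

Lemma fresh_popE s w : fresh s w -> pop s w = w.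
Proof. by case: w => //= e w /negPf ->. Qed.

Lemma odd_bit_double (s : bool) n : odd (s + n.*2) = s.
Proof. by rewrite oddD odd_double addbF oddb. Qed.

Lemma top_push s n w : fresh s w -> top s (push s n w) = n.
Proof.
rewrite /push; case: eqP => [->|_ _ /=]; first exact: fresh_top.
by rewrite odd_bit_double eqxx half_bit_double.
Qed.

Lemma pop_push s n w : fresh s w -> pop s (push s n w) = w.
Proof.
rewrite /push; case: eqP => [_|_ _ /=]; first exact: fresh_popE.
by rewrite odd_bit_double eqxx.
Qed.

Lemma valid_push s n w :
  fresh s w -> valid w -> isrep s n -> valid (push s n w).
Proof.
rewrite /push; case: eqP => //= /eqP n0 fw vw rn.
by rewrite half_bit_double odd_bit_double lt0n n0 rn fw.
Qed.

(** * Cosets of A in one factor K, and the action of K on normal forms *)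

Section Factor.
Variables (A K : groupType) (f : {group_hom A -> K}) (ev : nat -> K) (s : bool).
Hypotheses (f_inj : injective f) (ev0 : ev 0 = 1%g).
Hypothesis ev_surj : forall x, exists n, ev n = x.
Local Open Scope group_scope.

Lemma coset_code_subproof x : exists n, `[< range f (x * (ev n)^-1) >].
Proof.
have [n <-] := ev_surj x; exists n.
by apply/asboolP; exists 1; rewrite // gmulf1 mulgV.
Qed.

Definition coset_code x := ex_minn (coset_code_subproof x).

Lemma coset_quotient_subproof x : exists a, f a * ev (coset_code x) = x.
Proof.
rewrite /coset_code; case: ex_minnP => n /asboolP[a _ fa] _.
by exists a; rewrite fa mulgVK.
Qed.

(** The A-part of x once the representative of its coset is split off; it is unique because [f] is
    injective. *)
Definition coset_quotient x := projT1 (cid (coset_quotient_subproof x)).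

Lemma coset_quotientP x : f (coset_quotient x) * ev (coset_code x) = x.
Proof. exact: (projT2 (cid (coset_quotient_subproof x))). Qed.

Lemma range_coset a x : range f (f a * x) <-> range f x.
Proof.
split=> [[b _ fb]|[b _ <-]]; last by exists (a * b); rewrite // gmulfM.
by exists (a^-1 * b); rewrite // gmulfM gmulfV fb mulKg.
Qed.

Lemma coset_codeM a x : coset_code (f a * x) = coset_code x.
Proof.
rewrite /coset_code; case: ex_minnP => m /asboolP Pm min_m.
case: ex_minnP => n /asboolP Pn min_n; apply/eqP; rewrite eqn_leq.
rewrite min_m; last by apply/asboolP; rewrite -mulgA; apply/range_coset.
by rewrite min_n //; apply/asboolP/(range_coset a); rewrite mulgA.
Qed.

Lemma coset_quotientM a x : coset_quotient (f a * x) = a * coset_quotient x.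
Proof.
apply: f_inj; apply: (mulIg (ev (coset_code x))).
by rewrite -{1}(coset_codeM a) coset_quotientP gmulfM -mulgA coset_quotientP.
Qed.

(** An element and the representative of its coset differ by a left factor from A. *)
Lemma coset_code_ev x : coset_code (ev (coset_code x)) = coset_code x.
Proof. by rewrite -(coset_codeM (coset_quotient x)) coset_quotientP. Qed.

Lemma coset_quotient_ev n : coset_code (ev n) = n -> coset_quotient (ev n) = 1.
Proof.
move=> nE; apply: f_inj; apply: (mulIg (ev n)).
by rewrite -{2}nE coset_quotientP gmulf1 mul1g.
Qed.

Hypothesis isrepE : forall n, isrep s n = (coset_code (ev n) == n).

Lemma coset_code1 : coset_code (ev 0) = 0.
Proof.
rewrite /coset_code; case: ex_minnP => n _ /(_ 0).
rewrite leqn0 => /(_ _)/eqP; apply.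
by apply/asboolP; exists 1; rewrite // gmulf1 mulgV.
Qed.

Lemma coset_code_top w : valid w -> coset_code (ev (top s w)) = top s w.
Proof.
case: w => [_|e w /= /and4P[_ re _ _]]; first exact: coset_code1.
by case: eqP => [es|_]; [move: re; rewrite es isrepE => /eqP|exact: coset_code1].
Qed.

(** Left multiplication by [x]: only the A-part and a leading syllable from K can merge with [x], so
    these are multiplied in K and the product is split again into A-part and representative. *)
Definition act (x : K) (u : A * seq nat) : A * seq nat :=
  let y := x * f u.1 * ev (top s u.2) in
  (coset_quotient y, push s (coset_code y) (pop s u.2)).

Lemma valid_act x u : valid u.2 -> valid (act x u).2.
Proof.
move=> vu; apply: valid_push; [exact: fresh_pop|exact: valid_pop|].
by rewrite isrepE coset_code_ev.
Qed.

(** The result does not mention the factor, so the actions of B and C agree on A, as the universal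
    property demands. *)
Lemma act_range a u : valid u.2 -> act (f a) u = (a * u.1, u.2).
Proof.
case: u => b w /= vw; rewrite /act /= -gmulfM coset_quotientM coset_codeM.
rewrite coset_code_top // coset_quotient_ev ?coset_code_top // mulg1.
by rewrite push_topK.
Qed.

Lemma act1 u : valid u.2 -> act 1 u = u.
Proof.
by move=> vu; rewrite -(@gmulf1 _ _ f) act_range // mul1g -surjective_pairing.
Qed.

(** The A-part and the top syllable left by [act y u] multiply back to the element that was split,
    by [coset_quotientP]. *)
Lemma actM x y u : valid u.2 -> act (x * y) u = act x (act y u).
Proof.
move=> vu; rewrite {3}/act /= /act /= top_push ?pop_push ?fresh_pop //.
by rewrite -[x * f _ * _]mulgA coset_quotientP !mulgA.
Qed.

(* Extended by the identity to lists that are not normal forms, to be a permutation. *)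
Definition valid_act_fun x u := if valid u.2 then act x u else u.

Lemma valid_act_funM x y u :
  valid_act_fun (x * y) u = valid_act_fun x (valid_act_fun y u).
Proof.
rewrite /valid_act_fun; case: (boolP (valid u.2)) => [vu|/negPf -> //].
by rewrite valid_act // actM.
Qed.

Lemma valid_act_fun1 u : valid_act_fun 1 u = u.
Proof. by rewrite /valid_act_fun; case: ifP => // /act1. Qed.

Lemma valid_act_funK x : cancel (valid_act_fun x) (valid_act_fun x^-1).
Proof. by move=> u; rewrite -valid_act_funM mulVg valid_act_fun1. Qed.

Lemma valid_act_funVK x : cancel (valid_act_fun x^-1) (valid_act_fun x).
Proof. by move=> u; rewrite -valid_act_funM mulgV valid_act_fun1. Qed.

Definition act_symmetry x := Symmetry (valid_act_funK x) (valid_act_funVK x).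

Lemma act_symmetryM : {morph act_symmetry : x y / x * y}.
Proof. by move=> x y; apply: symmetry_eq => u; exact: valid_act_funM. Qed.

Lemma act_symmetry1 : act_symmetry 1 = 1.
Proof. by apply: symmetry_eq => u; exact: valid_act_fun1. Qed.

HB.instance Definition _ := isUMagmaMorphism.Build _ _ act_symmetry
  (conj act_symmetry1 act_symmetryM).

Section Value.
Variables (G : groupType) (i : {group_hom K -> G}) (j : nat -> G) (M : set G).
Hypothesis jE : forall n, j (s + n.*2) = i (ev n).

Definition nf_prod (w : seq nat) : G := foldr (fun e y => j e * y) 1 w.

Lemma nf_prod_push n w : nf_prod (push s n w) = i (ev n) * nf_prod w.
Proof.
by rewrite /push; case: eqP => [->|_]; rewrite /= ?jE // ev0 gmulf1 mul1g.
Qed.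

Lemma nf_prod_act x u : valid u.2 ->
  i (f (act x u).1) * nf_prod (act x u).2 = i x * (i (f u.1) * nf_prod u.2).
Proof.
move=> vu; rewrite /act /= nf_prod_push mulgA -gmulfM coset_quotientP.
by rewrite -{3}(push_topK s vu) nf_prod_push !gmulfM !mulgA.
Qed.

Definition good (w : seq nat) := forall e, e \in w -> M (j e).

Lemma good_act x u : submonoid M -> (forall a, M (i (f a))) -> M (i x) ->
  good u.2 -> good (act x u).2.
Proof.
move=> [M1 MM] MA Mx gu.
have Mtop : M (i (ev (top s u.2))).
  case: u.2 gu => [_|e w gw] /=; first by rewrite ev0 gmulf1.
  case: eqP => [es|_]; last by rewrite ev0 gmulf1.
  by rewrite -jE -es odd_double_half; apply: gw; rewrite mem_head.
have gpop : good (pop s u.2).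
  case: u.2 gu => // e w gw /=; case: ifP => // _ d dw; apply: gw.
  by rewrite inE dw orbT.
rewrite /act /=; set y := _ * _ * _.
(* The new representative is f(a)^-1 y. The inverse stays in M because A is a group contained in M,
   and y is a product of [x], an element of A and the old top syllable. *)
have Mcode : M (i (ev (coset_code y))).
  rewrite -[ev _](mulKg (f (coset_quotient y))) coset_quotientP -gmulfV.
  rewrite /y !gmulfM.
  by apply: (MM); [exact: MA|exact: (MM _ _ (MM _ _ Mx (MA _)) Mtop)].
rewrite /push; case: ifP => // _ e; rewrite inE.
move=> /predU1P[->|]; last exact: gpop.
by rewrite jE.
Qed.

End Value.
End Factor.
End NormalForms.

(** * Words and their values *)

Section Evaluation.
Local Open Scope group_scope.

Definition eval (K : groupType) (lv : nat -> K) (n : nat) : K :=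
  foldr (fun c x => lv c * x) 1 (CodeSeq.decode n).

Section EvalTheory.
Variables (K : groupType) (lv : nat -> K).

Lemma eval_cat m n : eval lv (code_cat m n) = eval lv m * eval lv n.
Proof.
rewrite /eval decode_cat foldr_cat.
by elim: (CodeSeq.decode m) => [|c s /= ->]; rewrite ?mul1g ?mulgA.
Qed.

Lemma eval_cons c n : eval lv (code_cons c n) = lv c * eval lv n.
Proof. by rewrite /eval decode_code_cons. Qed.

Lemma eval_inv n :
  (forall c, lv (if odd c then c.-1 else c.+1) = (lv c)^-1) ->
  eval lv (code_inv n) = (eval lv n)^-1.
Proof.
move=> lvV; rewrite /eval decode_inv.
elim: (CodeSeq.decode n) => [|c s IHs]; first by rewrite /= invg1.
rewrite map_cons rev_cons foldr_rcons /= lvV mulg1 invgM -IHs.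
by elim: (rev _) => [|d t /= ->]; rewrite /= ?mul1g ?mulgA.
Qed.

Lemma eval_subst (A : groupType) (f : {group_hom A -> K}) (lvA : nat -> A)
    (t : nat -> nat) n :
  (forall c, eval lv (t c) = f (lvA c)) ->
  eval lv (code_subst t n) = f (eval lvA n).
Proof.
move=> tE; rewrite /eval decode_subst.
elim: (CodeSeq.decode n) => [|c s IHs] /=; first by rewrite gmulf1.
rewrite gmulfM -IHs -tE foldr_cat /eval.
by elim: (CodeSeq.decode (t c)) => [|d r /= ->]; rewrite ?mul1g ?mulgA.
Qed.

End EvalTheory.

(* Letters out of range have value 1, so that every natural number codes a word. *)
Definition letter_value (K : groupType) (p : nat) (X : p.-tuple K) c : K :=
  if insub c./2 is Some i then
    if odd c then (tnth X i)^-1 else tnth X i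
  else 1.

Section Letters.
Variables (K : groupType) (p : nat) (X : p.-tuple K).
Local Notation ev := (eval (letter_value X)).

Lemma letter_valueV c :
  letter_value X (if odd c then c.-1 else c.+1) = (letter_value X c)^-1.
Proof.
set d := if _ then _ else _.
have dE : d = ~~ odd c + c./2.*2.
  rewrite /d -[c in if _ then c.-1 else _]odd_double_half.
  by rewrite -[c in if _ then _ else c.+1]odd_double_half; case: (odd c).
rewrite /letter_value dE half_bit_double oddD odd_double addbF oddb.
case: (insub c./2) => [i|]; last by rewrite invg1.
by case: (odd c); rewrite /= ?invgK.
Qed.

Lemma letter_value_code (l : letter p) :
  letter_value X (l.1.*2 + l.2) = if l.2 then (tnth X l.1)^-1 else tnth X l.1.
Proof.
rewrite /letter_value addnC half_bit_double oddD odd_double addbF oddb.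
rewrite insubT // => ltp.
by congr (if _ then (tnth X _)^-1 else tnth X _); exact: val_inj.
Qed.

Lemma word_value_cons (l : letter p) w : word_value X (l :: w) =
  (if l.2 then (tnth X l.1)^-1 else tnth X l.1) * word_value X w.
Proof. by rewrite /word_value big_cons. Qed.

Lemma word_valueE w : word_value X w = ev (word_code w).
Proof.
rewrite /eval /word_code CodeSeq.codeK; elim: w => [|l w IHw].
  by rewrite /word_value big_nil.
by rewrite word_value_cons IHw /= letter_value_code.
Qed.

Lemma eval_surj : generates X -> forall x, exists n, ev n = x.
Proof.
move=> gX x; have [w <-] := gX x.
by exists (word_code w); rewrite word_valueE.
Qed.

(** Letters out of range have value 1, so deleting them gives a genuine word of the same value. *)
Lemma eval_filter (s : seq nat) : exists w : seq (letter p),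
  word_code w = CodeSeq.code [seq c <- s | c < p.*2] /\
  word_value X w = foldr (fun c x => letter_value X c * x) 1 s.
Proof.
elim: s => [|c s [w [wE vE]]].
  by exists [::]; split=> //; rewrite word_valueE.
rewrite /=; case: ltnP => [ltcp|lepc].
  have ltc : (c./2 < p)%N by rewrite ltn_half_double.
  exists ((Ordinal ltc, odd c) :: w); rewrite word_value_cons vE; split.
    by rewrite /word_code /= -wE addnC odd_double_half.
  by congr (_ * _); rewrite /letter_value insubT.
exists w; split=> //; rewrite vE /letter_value insubF ?mul1g //.
by rewrite ltn_half_double ltnNge lepc.
Qed.

Lemma recursive_membership (N : set K) : decidable_membership X N ->
  @recursive 1 (fun v => `[< N (ev (thead v)) >] : nat).
Proof.
move=> [chi rchi chiE].
(* [chi] is specified only on codes of genuine words, so letters out of range are first replaced by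
   the empty word. *)
pose t c := if (c < p.*2)%N then code_cons c 0 else 0.
have rt : @recursive 1 (fun v => t (thead v)).
  apply: recursive_if.
  - exact: recursive_leq (recursive_S (recursive_thead 0)) (recursive_const _ _).
  - exact: recursive_code_cons (recursive_thead 0) (recursive_const _ _).
  - exact: recursive_const.
pose t' (v : 1.-tuple nat) : 1.-tuple nat := [tuple code_subst t (thead v)].
have rt' i : recursive (fun v => tnth (t' v) i).
  apply: recursive_ext (recursive_code_subst rt (recursive_thead 0)) => v.
  by rewrite ord1.
apply: recursive_ext (recursive_subst rchi rt') => v.
have [w [wE vE]] := eval_filter (CodeSeq.decode (thead v)).
rewrite /eval -vE -chiE wE; congr (chi [tuple _]).
rewrite -[LHS]CodeSeq.decodeK decode_subst; congr CodeSeq.code.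
elim: (CodeSeq.decode _) => //= c s ->.
by rewrite /t; case: ifP => // _; rewrite decode_code_cons.
Qed.

End Letters.

End Evaluation.

(** * Computability of the action of one letter *)

Section Step.
Variables (A K : groupType) (f : {group_hom A -> K}) (r p : nat).
Variables (Z : r.-tuple A) (X : p.-tuple K) (s : bool).
Hypotheses (f_inj : injective f) (hZ : generates Z) (hX : generates X).
Hypothesis wpK : decidable_word_problem X.
Hypothesis mpK : decidable_membership X (range f).
Local Open Scope group_scope.

Local Notation evA := (eval (letter_value Z)).
Local Notation ev := (eval (letter_value X)).

Lemma least_code_subproof a : exists n, evA n == a.
Proof. by have [n <-] := eval_surj hZ a; exists n. Qed.

(** A canonical word for each element of A, so that every normal form has exactly one code. *)
Definition least_code a := ex_minn (least_code_subproof a).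

Lemma eval_least_code a : evA (least_code a) = a.
Proof. by rewrite /least_code; case: ex_minnP => n /eqP. Qed.

Lemma recursive_letter_word : exists2 t : nat -> nat,
  @recursive 1 (fun v => t (thead v)) &
  forall c, ev (t c) = f (letter_value Z c).
Proof.
have tP c : exists n, ev n = f (letter_value Z c) by exact: eval_surj.
pose t c := projT1 (cid (tP c)).
(* Past the table [nth] returns 0, the empty word, in accordance with the value 1 of letters out of
   range. *)
exists (fun c => nth 0 (mkseq t r.*2) c).
  exact: recursive_nth (recursive_thead 0).
move=> c; case: (ltnP c r.*2) => [lt_c|le_c].
  by rewrite nth_mkseq //; exact: projT2 (cid (tP c)).
rewrite nth_default ?size_mkseq // /letter_value insubF ?gmulf1 //.
by rewrite ltn_half_double ltnNge le_c.
Qed.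

Local Notation cc := (coset_code f (eval_surj hX)).
Local Notation cq := (coset_quotient f (eval_surj hX)).

(** Each candidate n is tested by the membership problem for A in K, on the word x n^-1. *)
Lemma recursive_coset_code k (F : k.-tuple nat -> nat) :
  recursive F -> recursive (fun v => cc (ev (F v))).
Proof.
move=> rF; pose P v n := `[< range f (ev (code_cat (F v) (code_inv n))) >].
have PE v n : P v n = `[< range f (ev (F v) * (ev n)^-1) >].
  by rewrite /P eval_cat eval_inv //; exact: letter_valueV.
have hP v : exists n, P v n.
  have [n Pn] := coset_code_subproof f (eval_surj hX) (ev (F v)).
  by exists n; rewrite PE.
apply: recursive_ext (recursive_ex_minn hP _) => [v|].
  by apply: eq_ex_minn => n; rewrite PE.
apply: (recursive_comp1 (h := fun m => `[< range f (ev m) >])).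
  exact: recursive_membership.
apply: recursive_code_cat; first exact: recursive_behead.
exact: recursive_code_inv (recursive_thead k).
Qed.

Lemma recursive_quotient_code k (F : k.-tuple nat -> nat) :
  recursive F -> recursive (fun v => least_code (cq (ev (F v)))).
Proof.
move=> rF; have [t rt tE] := recursive_letter_word.
(* With a the value of [n] and t the representative, this is f(a) t x^-1 = 1, an instance of the
   word problem of K; by injectivity of [f] it singles out the A-part of x. *)
pose P v n := `[< ev (code_cat (code_subst t n)
  (code_cat (cc (ev (F v))) (code_inv (F v)))) = 1 >].
have PE v n : P v n = (evA n == cq (ev (F v))).
  rewrite /P !eval_cat eval_inv; last exact: letter_valueV.
  rewrite (eval_subst _ tE).
  apply/asboolP/eqP => [/(canRL (mulgK _))|->].
    rewrite mul1g invgM invgK => e; apply: f_inj.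
    by rewrite e -{1}(coset_quotientP f (eval_surj hX) (ev (F v))) mulgK.
  by rewrite mulgA coset_quotientP mulgV.
have hP v : exists n, P v n.
  have [n Pn] := least_code_subproof (cq (ev (F v))).
  by exists n; rewrite PE.
apply: recursive_ext (recursive_ex_minn hP _) => [v|].
  by apply: eq_ex_minn => n; rewrite PE.
apply: (recursive_comp1 (h := fun m => `[< ev m = 1 >])).
  exact: (recursive_membership (N := [set 1])).
apply: recursive_code_cat.
  exact: recursive_code_subst rt (recursive_thead k).
have rF' := recursive_behead rF; apply: recursive_code_cat.
  exact: recursive_coset_code.
exact: recursive_code_inv.
Qed.

Definition code_top n := if odd (code_head n) == s then (code_head n)./2 else 0.
Definition code_pop n := if odd (code_head n) == s then code_behead n else n.
Definition code_push m n := if m == 0 then n else code_cons (s + m.*2) n.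

(** On the empty sequence the default head 0 gives 0 for either factor, as [top] does. *)
Lemma code_topE n : code_top n = top s (CodeSeq.decode n).
Proof.
by rewrite /code_top /code_head; case: CodeSeq.decode => //=; rewrite if_same.
Qed.

Lemma code_popE w : code_pop (CodeSeq.code w) = CodeSeq.code (pop s w).
Proof.
rewrite /code_pop /code_head /code_behead CodeSeq.codeK.
by case: w => //= [|e w]; case: ifP.
Qed.

Lemma code_pushE m w : code_push m (CodeSeq.code w) = CodeSeq.code (push s m w).
Proof. by rewrite /code_push /push; case: ifP. Qed.

Definition nf_code (u : A * seq nat) :=
  code_cons (least_code u.1) (CodeSeq.code u.2).

Lemma recursive_act_code : exists2 step : nat -> nat -> nat,
  forall k (F H : k.-tuple nat -> nat), recursive F -> recursive H ->
    recursive (fun v => step (F v) (H v)) &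
  forall c u, step c (nf_code u) =
    nf_code (act f s (eval_surj hX) (letter_value X c) u).
Proof.
have [t rt tE] := recursive_letter_word.
(* A word for the product that [act] splits: the letter, the image of the A-part, the top
   syllable. *)
pose word c n := code_cons c
  (code_cat (code_subst t (code_head n)) (code_top (code_behead n))).
exists (fun c n => code_cons (least_code (cq (ev (word c n))))
  (code_push (cc (ev (word c n))) (code_pop (code_behead n))))
  => [k F H rF rH|c [a w]].
  have rb := recursive_code_behead rH; have rh := recursive_code_head rb.
  have rs : recursive (fun v => odd (code_head (code_behead (H v))) == s : nat).
    have ro := recursive_odd rh; case: (s).
      by apply: recursive_ext ro => v; case: odd.
    by apply: recursive_ext (recursive_negb ro) => v; case: odd.
  have rw : recursive (fun v => word (F v) (H v)).
    apply: recursive_code_cons rF _; apply: recursive_code_cat.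
      exact: recursive_code_subst rt (recursive_code_head rH).
    exact: recursive_if rs (recursive_half rh) (recursive_const k 0).
  have rc := recursive_coset_code rw.
  have rp : recursive (fun v => code_pop (code_behead (H v))).
    exact: recursive_if rs (recursive_code_behead rb) rb.
  apply: recursive_code_cons; first exact: recursive_quotient_code.
  apply: recursive_if (recursive_eq0 rc) rp (recursive_code_cons _ rp).
  exact: recursive_add (recursive_const k s) (recursive_double rc).
have -> : ev (word c (nf_code (a, w))) =
    letter_value X c * f a * ev (top s w).
  rewrite /word /nf_code code_headK code_beheadK eval_cons eval_cat.
  by rewrite (eval_subst _ tE) eval_least_code code_topE CodeSeq.codeK mulgA.
by rewrite /nf_code code_beheadK code_popE code_pushE.
Qed.

End Step.

(** * Membership in the amalgamated product *)

Section Amalgam.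
Variables (A B C G : groupType).
Variables (f : {group_hom A -> B}) (g : {group_hom A -> C}).
Variables (iB : {group_hom B -> G}) (iC : {group_hom C -> G}).
Variables (evB : nat -> B) (evC : nat -> C) (M : set G).
Hypothesis hG : amalgamated_product f g iB iC.
Local Open Scope group_scope.
Hypotheses (evB0 : evB 0 = 1) (evC0 : evC 0 = 1).
Hypothesis evB_surj : forall x, exists n, evB n = x.
Hypothesis evC_surj : forall x, exists n, evC n = x.
Hypothesis hM : submonoid M.
Hypothesis hAM : range (iB \o f) `<=` M.
Hypothesis genM :
  M = submonoid_generated ((M `&` range iB) `|` (M `&` range iC)).

Local Notation ccB := (coset_code f evB_surj).
Local Notation ccC := (coset_code g evC_surj).
Local Notation actB := (act f false evB_surj).
Local Notation actC := (act g true evC_surj).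

Definition syllable_value e := if odd e then iC (evC e./2) else iB (evB e./2).

Let rep (s : bool) n := if s then ccC (evC n) == n else ccB (evB n) == n.

Let f_inj : injective f. Proof. by case: hG. Qed.
Let g_inj : injective g. Proof. by case: hG. Qed.
Let fg a : iB (f a) = iC (g a). Proof. by case: hG. Qed.

Let repB n : rep false n = (ccB (evB n) == n). Proof. by []. Qed.
Let repC n : rep true n = (ccC (evC n) == n). Proof. by []. Qed.

Let valueB n : syllable_value (false + n.*2) = iB (evB n).
Proof. by rewrite /syllable_value odd_bit_double half_bit_double. Qed.

Let valueC n : syllable_value (true + n.*2) = iC (evC n).
Proof. by rewrite /syllable_value odd_bit_double half_bit_double. Qed.

Lemma amalgam_action : exists h : {group_hom G -> symmetry (A * seq nat)},
  (forall b u, valid rep u.2 -> h (iB b) u = actB b u) /\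
  (forall c u, valid rep u.2 -> h (iC c) u = actC c u).
Proof.
case: hG => _ _ _ univ.
(* Both sides multiply the A-part by [a] and leave the syllables alone. *)
have fgE a : act_symmetry f_inj repB (f a) = act_symmetry g_inj repC (g a).
  apply: symmetry_eq => u /=; rewrite /valid_act_fun; case: ifP => // vu.
  by rewrite (act_range f_inj repB) // (act_range g_inj repC).
have [h [hB hC _]] :=
  univ _ (act_symmetry f_inj repB) (act_symmetry g_inj repC) fgE.
exists h; split=> [b|c] u vu; rewrite ?hB ?hC /=.
  by rewrite /valid_act_fun vu.
by rewrite /valid_act_fun vu.
Qed.

Definition sum_value (l : B + C) :=
  match l with inl b => iB b | inr c => iC c end.
Definition sum_act (l : B + C) :=
  match l with inl b => actB b | inr c => actC c end.

Lemma amalgam_membership (w : seq (B + C)) :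
  M (foldr (fun l x => sum_value l * x) 1 w) <->
  good syllable_value M (foldr sum_act (1, [::]) w).2.
Proof.
have [M1 MM] := hM.
have MA a : M (iB (f a)) by apply: hAM; exists a.
have [h [hB hC]] := amalgam_action.
set x := foldr _ 1 w; set u := foldr sum_act _ w.
(* Along the word, the computed pair stays valid, is the image of the normal form of 1 under the
   element read so far, and has that element as its product. *)
have [vu hx xE] : [/\ valid rep u.2, h x (1, [::]) = u &
    iB (f u.1) * nf_prod syllable_value u.2 = x].
  rewrite /x /u; elim: w {x u} => [|l w [vu hx xE]] /=.
    by split; rewrite ?gmulf1 ?mul1g.
  rewrite gmulfM symmetryME hx; case: l => [b|c] /=.
    rewrite hB // (valid_act repB) //.
    by rewrite (nf_prod_act (isrep := rep) f evB0 evB_surj valueB) // xE.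
  rewrite hC // (valid_act repC) //.
  rewrite fg (nf_prod_act (isrep := rep) g evC0 evC_surj valueC) //.
  by rewrite -fg xE.
split=> [|gu]; last first.
  rewrite -xE; apply: (MM _ _ (MA _)).
  elim: u.2 gu {vu hx xE} => //= e s IHs ges.
  apply: MM; first by apply: ges; rewrite mem_head.
  by apply: IHs => d ds; apply: ges; rewrite inE ds orbT.
(* The elements that preserve the valid good normal forms are a submonoid. Once it contains M,
   applying [x] to the empty normal form, which is vacuously good, yields the claim. *)
pose N := [set y | forall v, valid rep v.2 -> good syllable_value M v.2 ->
  valid rep (h y v).2 /\ good syllable_value M (h y v).2].
suff MN : M `<=` N by move=> /MN/(_ (1, [::])); rewrite hx; case.
rewrite {1}genM; apply: smallest_sub.
  split=> [v vv gv|y z Ny Nz v vv gv]; first by rewrite gmulf1.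
  by rewrite gmulfM symmetryME; have [] := Nz v vv gv; exact: Ny.
move=> y [[My [b _ yE]]|[My [c _ yE]]] v vv gv;
  rewrite -yE in My *; rewrite ?hB ?hC //.
  split; first exact: (valid_act repB).
  exact: (good_act evB0 valueB).
split; first exact: (valid_act repC).
by apply: (good_act evC0 valueC) => // a; rewrite -fg.
Qed.

End Amalgam.

(** * Reading words over the generators of G as products of letters from B and C *)

Section Decision.
Variables (B C G : groupType).
Variables (iB : {group_hom B -> G}) (iC : {group_hom C -> G}).
Variables (p q : nat) (X : p.-tuple B) (Y : q.-tuple C).
Local Open Scope group_scope.

(** The generators of B come first and use the codes below 2p; the shift for C is even, so it keeps
    the parity that marks inverses. *)
Definition split_letter c : B + C :=
  if (c < p.*2)%N then inl (letter_value X c)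
  else inr (letter_value Y (c - p.*2)).

Lemma letter_value_cat c : letter_value [tuple of map iB X ++ map iC Y] c =
  sum_value iB iC (split_letter c).
Proof.
have tE i y : y = tnth [tuple of map iB X ++ map iC Y] i ->
    y = if (i < p)%N then iB (nth 1 X i) else iC (nth 1 Y (i - p)).
  move=> ->; rewrite (tnth_nth 1) nth_cat size_map size_tuple.
  case: ltnP => [lt_ip|le_pi]; first by rewrite (nth_map 1) ?size_tuple.
  by rewrite (nth_map 1) // size_tuple ltn_subLR.
rewrite /split_letter; case: ltnP => [lt_c|le_c] /=; rewrite /letter_value.
  have ltp : (c./2 < p)%N by rewrite ltn_half_double.
  rewrite !insubT ?ltn_addr //= => ltpq.
  rewrite (tE _ _ erefl) /= ltp (tnth_nth 1) /=.
  by case: ifP; rewrite ?gmulfV.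
have -> : (c - p.*2)./2 = (c./2 - p)%N.
  by rewrite -{2}(subnKC le_c) halfD odd_double doubleK add0n addKn.
have -> : odd (c - p.*2) = odd c by rewrite oddB // odd_double addbF.
have lepc : (p <= c./2)%N by rewrite geq_half_double.
case: (ltnP (c./2 - p)%N q) => [ltq|leq].
  have ltpq : (c./2 < p + q)%N by rewrite -ltn_subLR.
  rewrite !insubT /= (tE _ _ erefl) /= ltnNge lepc /= (tnth_nth 1) /=.
  by case: ifP; rewrite ?gmulfV.
by rewrite !insubF ?gmulf1 // ltnNge ?leq // -leq_subRL ?leq.
Qed.

Lemma word_value_split (w : seq (letter (p + q))) :
  word_value [tuple of map iB X ++ map iC Y] w =
  foldr (fun l x => sum_value iB iC l * x) 1
    (map split_letter (CodeSeq.decode (word_code w))).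
Proof.
rewrite word_valueE /eval; elim: (CodeSeq.decode _) => //= c s ->.
by rewrite letter_value_cat.
Qed.

End Decision.

Theorem theoremA (A B C G : groupType)
    (f : {group_hom A -> B}) (g : {group_hom A -> C})
    (iB : {group_hom B -> G}) (iC : {group_hom C -> G})
    (p q r : nat) (X : p.-tuple B) (Y : q.-tuple C) (Z : r.-tuple A)
    (M : set G)
    (hG : amalgamated_product f g iB iC)
    (hX : generates X) (hY : generates Y) (hZ : generates Z)
    (wpB : decidable_word_problem X) (wpC : decidable_word_problem Y)
    (mpAB : decidable_membership X (range f))
    (mpAC : decidable_membership Y (range g))
    (hM : submonoid M)
    (hAM : range (iB \o f) `<=` M)
    (fgMB : finitely_generated_submonoid (M `&` range iB))
    (fgMC : finitely_generated_submonoid (M `&` range iC))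
    (genM : M = submonoid_generated ((M `&` range iB) `|` (M `&` range iC)))
    (mpMB : decidable_membership X (iB @^-1` M))
    (mpMC : decidable_membership Y (iC @^-1` M)) :
  decidable_membership [tuple of map iB X ++ map iC Y] M.
Proof.
have [f_inj g_inj _ _] := hG.
have [stepB rB stepBE] := recursive_act_code false f_inj hZ hX wpB mpAB.
have [stepC rC stepCE] := recursive_act_code true g_inj hZ hY wpC mpAC.
have rMB := recursive_membership mpMB; have rMC := recursive_membership mpMC.
pose step c n := if (c < p.*2)%N then stepB c n else stepC (c - p.*2) n.
pose e0 := nf_code hZ (1%g, [::]).
(* The last letter acts first, while the fold runs from the left; hence the word is reversed. *)
pose nf x := code_foldl (fun n c => step c n) e0 (code_revcat x 0).
pose inM e := if odd e then `[< M (iC (eval (letter_value Y) e./2)) >]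
  else `[< M (iB (eval (letter_value X) e./2)) >].
(* [code_behead] drops the A-part, which lies in M anyway; the fold is the conjunction of the tests
   on the syllables, with 1 for true. *)
pose chi x :=
  code_foldl (fun b e => if inM e then b else 0) 1 (code_behead (nf x)).
have rinM : @recursive 3 (fun w => inM (thead w) : nat).
  have rh := recursive_thead 2.
  have := recursive_if (recursive_odd rh)
    (recursive_comp1 (h := fun n => `[< M (iC (eval (letter_value Y) n)) >])
      rMC (recursive_half rh))
    (recursive_comp1 (h := fun n => `[< M (iB (eval (letter_value X) n)) >])
      rMB (recursive_half rh)).
  by apply: recursive_ext => w; rewrite /inM; case: ifP.
have rnf k (F : k.-tuple nat -> nat) :
    recursive F -> recursive (fun v => nf (F v)).
  move=> rF; apply: (recursive_code_foldl (h := fun _ n c => step c n)).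
  - have rc := recursive_thead k.+1.
    have rn := recursive_behead (recursive_thead k).
    have rp := recursive_const k.+2 p.*2.
    exact: recursive_if (recursive_leq (recursive_S rc) rp) (rB _ _ _ rc rn)
      (rC _ _ _ (recursive_sub rc rp) rn).
  - exact: recursive_const.
  - exact: recursive_code_revcat rF (recursive_const k 0).
have rchi : @recursive 1 (fun v => chi (thead v)).
  apply: (recursive_code_foldl (h := fun _ b e => if inM e then b else 0)).
  - exact: recursive_if rinM (recursive_behead (recursive_thead 1))
      (recursive_const 3 0).
  - exact: recursive_const.
  - exact: recursive_code_behead (rnf _ _ (recursive_thead 0)).
exists (fun v => chi (thead v)) => // w.
have MP := amalgam_membership hG (erefl : eval (letter_value X) 0 = 1%g)
  (erefl : eval (letter_value Y) 0 = 1%g)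
  (eval_surj hX) (eval_surj hY) hM hAM genM.
rewrite theadE /=; set x := word_code w.
have nfE : nf x = nf_code hZ (foldr (sum_act f g (eval_surj hX) (eval_surj hY))
    (1%g, [::]) [seq split_letter X Y c | c <- CodeSeq.decode x]).
  rewrite /nf /code_foldl decode_revcat catrevE cats0 foldl_rev.
  elim: (CodeSeq.decode x) => //= c s ->; rewrite /step /split_letter.
  by case: ifP => _; [exact: stepBE|exact: stepCE].
have -> : `[< M (word_value [tuple of map iB X ++ map iC Y] w) >] =
   all inM (CodeSeq.decode (code_behead (nf x))).
  apply/asboolP/allP => [|allM].
    rewrite word_value_split => /MP gw e.
    rewrite nfE code_beheadK CodeSeq.codeK => /gw.
    by rewrite /syllable_value /inM; case: ifP => _ ?; apply/asboolP.
  rewrite word_value_split; apply/MP => e.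
  move: allM; rewrite nfE code_beheadK CodeSeq.codeK => /(_ e)/[apply].
  by rewrite /syllable_value /inM; case: ifP => _ /asboolP.
rewrite /chi /code_foldl.
have fold0 s : foldl (fun b e => if inM e then b else 0) 0 s = 0.
  by elim: s => //= e s; rewrite if_same.
by elim: (CodeSeq.decode _) => //= e s IHs; case: (inM e).
Qed.
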